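(* Let $X=E\times D$ be the economic state space with $\sigma$-algebra $\mathcal{X}$, let $q:E\times\mathcal{E}\to[0,1]$ be a Markov transition probability on the exogenous space $(E,\mathcal{E})$, and let $F$ be an upper hemicontinuous correspondence from $X\times E$ to $X$. Suppose: 1. there exists $K\in\mathcal{X}$ such that $f(x,e)\in K$ for all $e\in E$, all $x\in X$ and all measurable selections $f$ from $F$; 2. there exist $e^*\in E$, $x^*\in X$ and $n\in\mathbb{N}$ such that $f^{(n)}(x,e^* )=x^*$ for all $x\in K$ and all measurable selections $f$ from $F$; 3. there exists $\epsilon>0$ such that $q(e,\{e^*\})\ge\epsilon$ for all $e\in E$. Then, for every measurable selection $f$ from $F$, the transition probability $p$ induced by $f$ and $q$ satisfies: there exists a probability measure $\mu^*$ on $(X,\mathcal{X})$ such that for every $g\in M^*$ and every $x\in X$, $$\frac1n\sum_{i=0}^{n-1}(T^* )^ig(x)\ \longrightarrow\ \int_Xg(y)\,\mu^*(dy)\qquad(n\to\infty).$$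
   Context: Setting. A state of the economy is $x_t=(e_t,d_t)\in X=E\times D$, with $e_t$ exogenous and $d_t$ endogenous; $E$ and $X$ carry topologies and (Borel) $\sigma$-algebras $\mathcal{E}$, $\mathcal{X}$. The exogenous process $(e_t)_{t\ge0}$ is a Markov process on $(E,\mathcal{E})$ with transition probability $q$. A law of evolution is a measurable selection $f:X\times E\to X$ from $F$ (i.e. $f$ is measurable and $f(x,e)\in F(x,e)$), and the state evolves by $x_t=(e_t,d_t)=f(x_{t-1},e_t)$ (so the $E$-component of $f(x,e)$ is $e$). Iterates with the exogenous variable held fixed are defined by $f^{(1)}=f$ and $f^{(n)}(x,e):=f(f^{(n-1)}(x,e),e)$. The transition probability induced by $f$ and $q$ is $p:X\times\mathcal{X}\to[0,1]$, $p(x,A):=q\big(e_x,\{e\in E: f(x,e)\in A\}\big)$, where $e_x$ is the exogenous ($E$-)component of $x$. $M^*$ is the Banach space of all complex-valued bounded Borel measurable functions on $(X,\mathcal{X})$ with the supremum norm, and $T^*g(x):=\int_Xg(t)\,p(x,dt)$ for $g\in M^*$, with iterates $(T^* )^i$ and $(T^* )^0=I$. *)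

(* Defs.v *)
From HB Require Import structures.
From mathcomp Require Import all_boot all_order all_algebra.
From mathcomp Require Import complex.
From mathcomp Require Import all_classical all_reals all_analysis.
From mathcomp Require Import measurable_realfun.

Set Implicit Arguments.
Unset Strict Implicit.
Unset Printing Implicit Defensive.

Import Order.TTheory GRing.Theory Num.Theory.
Import numFieldNormedType.Exports.

Local Open Scope classical_set_scope.
Local Open Scope ring_scope.

(* A copy of [T] that keeps its topology and carries its Borel sigma-algebra.
   On a product, [borel (E * D)] has the Borel sigma-algebra of the product
   topology, whereas [borel E * borel D] has the product sigma-algebra. *)
Definition borel (T : ptopologicalType) : Type := T.

HB.instance Definition _ (T : ptopologicalType) :=
  PointedTopological.on (borel T).
HB.instance Definition _ (T : ptopologicalType) :=
  Measurable.copy (borel T) (g_sigma_algebraType (@open T)).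

(* The library leaves this join of the pointed and topological structures of a
   product undeclared. *)
HB.saturate prod.

Notation state E D := (borel (E * D)%type).

(* The topology on [R[i]] is declared in the library on [R[i]^o]. *)
Notation cplx R := (R[i]%C^o).

Definition upper_hemicontinuous (S T : topologicalType) (F : S -> set T) :=
  forall (z : S) (V : set T), open V -> F z `<=` V ->
    \forall z' \near z, F z' `<=` V.

Section model.
Variables (R : realType) (E D : ptopologicalType).
Implicit Types (F : state E D * borel E -> set (state E D))
  (f : {mfun (state E D * borel E)%type >-> state E D})
  (q : R.-pker (borel E) ~> (borel E)).

Definition exo (x : state E D) : borel E := x.1.

(* The measurability of a selection is carried by the type of [f]; it refers to
   the product of the Borel sigma-algebras of the states and of [E]. *)
Definition selection F f := forall z, F z (f z).

(* [exo_iter f n (x, e)] is f^(n)(x, e): [e] is held fixed along the iteration. *)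
Definition exo_iter f (n : nat) (z : state E D * borel E) : state E D :=
  iter n (fun y => f (y, z.2)) z.1.

Definition induced q f (x : state E D) (A : set (state E D)) : \bar R :=
  q (exo x) [set e | A (f (x, e))].

Lemma measurable_exo : measurable_fun [set: state E D] exo.
Proof.
rewrite /exo; apply: (@measurability _ _ (state E D) (borel E) _ _ (@open E)) => //.
move=> _ [U oU <-]; rewrite setTI; apply: sub_sigma_algebra.
by apply: open_comp => // x _; exact: cvg_fst.
Qed.

Section induced_kernel.
Variables (q : R.-pker (borel E) ~> (borel E)).
Variable f : {mfun (state E D * borel E)%type >-> state E D}.

Let mf x : measurable_fun [set: borel E] (fun e => f (x, e)).
Proof. exact: measurableT_comp. Qed.

Let induced0 x : induced q f x set0 = 0%E.
Proof. exact: measure0. Qed.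

Let induced_ge0 x A : (0 <= induced q f x A)%E.
Proof. exact: measure_ge0. Qed.

Let induced_sigma_additive x : semi_sigma_additive (induced q f x).
Proof. exact: (@measure_semi_sigma_additive _ _ _ (pushforward (q (exo x)) (fun e => f (x, e)))). Qed.

HB.instance Definition _ x := isMeasure.Build _ _ _ (induced q f x)
  (induced0 x) (@induced_ge0 x) (@induced_sigma_additive x).

Let qx (x : state E D) : {measure set (borel E) -> \bar R} := q (exo x).

Let measurable_qx U : measurable U -> measurable_fun [set: state E D] (qx ^~ U).
Proof.
by move=> mU; exact: (measurableT_comp (measurable_kernel q U mU) measurable_exo).
Qed.

HB.instance Definition _ := isKernel.Build _ _ _ _ _ qx measurable_qx.

Let qxT x : qx x setT = 1%E.
Proof. exact: prob_kernel. Qed.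

HB.instance Definition _ := Kernel_isProbability.Build _ _ _ _ _ qx qxT.

Definition transition (x : state E D) : {measure set (state E D) -> \bar R} :=
  induced q f x.

Let measurable_transition A :
  measurable A -> measurable_fun [set: state E D] (transition ^~ A).
Proof.
move=> mA.
rewrite (_ : _ ^~ A = fun x => qx x (xsection (f @^-1` A) x)); last first.
  by apply/funext => x; congr (q _ _); apply/seteqP; split => e;
    rewrite /xsection/= inE.
apply: measurable_fun_xsection_finite_kernel.
by rewrite inE -[X in measurable X]setTI; exact: measurable_funPT.
Qed.

HB.instance Definition _ :=
  isKernel.Build _ _ _ _ _ transition measurable_transition.

Let transitionT x : transition x setT = 1%E.
Proof. exact: prob_kernel. Qed.

HB.instance Definition _ :=
  Kernel_isProbability.Build _ _ _ _ _ transition transitionT.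

End induced_kernel.
End model.

Section markov_operator.
Context d (X : measurableType d) (R : realType).
Implicit Types (g : X -> cplx R) (mu : {measure set X -> \bar R}).

Definition Mstar g :=
  measurable_fun [set: X] (g : X -> borel (cplx R)) /\
  exists M : R, forall x, `|g x| <= M%:C%C.

(* Componentwise, the two real integrals being [Rintegral];
   for g in M* and mu finite both components are integrable. *)
Definition cintegral mu g : cplx R :=
  (\int[mu]_x complex.Re (g x) +i* \int[mu]_x complex.Im (g x))%C.

Definition Tstar (p : R.-pker X ~> X) g : X -> cplx R :=
  fun x => cintegral (p x) g.

End markov_operator.

(* Main.v *)
Require Import Defs.
From HB Require Import structures.
From mathcomp Require Import all_boot all_order all_algebra.
From mathcomp Require Import complex.
From mathcomp Require Import all_classical all_reals all_analysis.
From mathcomp Require Import measurable_realfun.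
From mathcomp Require Import lra.

Import Order.TTheory GRing.Theory Num.Theory.
Import numFieldNormedType.Exports.

Local Open Scope classical_set_scope.
Local Open Scope ring_scope.

(** The state [xstar] is an atom that the chain reaches, from anywhere and in a
bounded number of steps, with a probability bounded below. Indeed the exogenous
process jumps to [estar] with probability at least [eps] wherever it is. Of
n + 1 such jumps in a row, the first brings the state into [K] and the others
bring it to [xstar]. Hence, writing T for the real Markov operator, N = n + 1
and a = eps ^ N,

   T^N g x >= a * g xstar    for every x and every bounded measurable g >= 0

([iter_transition_ge_atom]). This is Doeblin's minorization condition. It is
phrased with functions rather than with sets because the singleton of [xstar]
need not be measurable.

Applied to g - b and to c - g, the minorization shows that T^N maps a function
with values in [b, c] to a function with values in an interval shorter by the
factor 1 - a ([oscillation_iter]). So T^k g converges uniformly to a constant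
l g, at a rate that depends on g only through its bound
([iter_markov_op_cauchy]).

It remains to see that l is the integral for some probability measure
([mean_representation]). Positivity, linearity and l 1 = 1 are inherited from
the integrals g |-> T^k g x. Countable additivity holds because the rate of
convergence is uniform on uniformly bounded functions: if g_j tends to 0
pointwise and boundedly, then T^k g_j x tends to 0 for each fixed k, and l g_j
differs from it by an error that is small for large k, uniformly in j.

The averages of a convergent sequence converge to its limit, and T* acts
separately on real and imaginary parts; this gives the complex statement. *)

(** * Means: integration against a probability, seen as a functional *)

Section bounded_measurable.
Context {d} {X : measurableType d} {R : realType}.
Implicit Types (g h : X -> R) (A : set X) (l : (X -> R) -> R).

Definition bounded_measurable g :=
  measurable_fun [set: X] g /\ exists M : R, forall x, `|g x| <= M.

Lemma bounded_measurable_cst (c : R) : bounded_measurable (fun=> c).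
Proof. by split; [exact: measurable_cst|exists `|c|]. Qed.

Lemma bounded_measurable_indic A : measurable A -> bounded_measurable \1_A.
Proof.
move=> mA; split; first exact: measurable_indic.
by exists 1 => x; rewrite indicE; case: (x \in A); rewrite ?normr1 ?normr0.
Qed.

Lemma bounded_measurable_lin (a : R) g h :
  bounded_measurable g -> bounded_measurable h ->
  bounded_measurable (fun x => a * g x + h x).
Proof.
move=> [mg [M gM]] [mh [N hN]]; split.
  by apply: measurable_funD => //; exact: measurable_funM.
exists (`|a| * M + N) => x; rewrite (le_trans (ler_normD _ _))// lerD//.
by rewrite normrM ler_wpM2l.
Qed.

Lemma bounded_measurableB g h :
  bounded_measurable g -> bounded_measurable h ->
  bounded_measurable (fun x => g x - h x).
Proof.
move=> bg bh; rewrite (_ : (fun _ => _) = fun x => -1 * h x + g x).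
  exact: bounded_measurable_lin.
by apply/funext => x; rewrite mulN1r addrC.
Qed.

Lemma bounded_measurable_sum I (s : seq I) (a : I -> R) (g : I -> X -> R) :
  (forall i, bounded_measurable (g i)) ->
  bounded_measurable (fun x => \sum_(i <- s) a i * g i x).
Proof.
move=> bg; elim: s => [|i s ih].
  by under eq_fun do rewrite big_nil; exact: bounded_measurable_cst.
under eq_fun do rewrite big_cons.
exact: bounded_measurable_lin.
Qed.

(** These are the properties of integration against a probability measure that
make sense for a functional. They pass to the iterates of a Markov operator and
to uniform limits directly, so that neither the powers of a kernel nor limits
of measures have to be built; [mean_representation] gives back a measure. *)
Record is_mean l : Prop := IsMean {
  mean1 : l (fun=> 1) = 1 ;
  mean_lin : forall (a : R) g h, bounded_measurable g -> bounded_measurable h ->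
    l (fun x => a * g x + h x) = a * l g + l h ;
  mean_ge0 : forall g, bounded_measurable g ->
    (forall x, 0 <= g x) -> 0 <= l g ;
  mean_cvg0 : forall (g : nat -> X -> R) (M : R),
    (forall j, measurable_fun [set: X] (g j)) ->
    (forall j x, `|g j x| <= M) ->
    (forall x, g ^~ x @ \oo --> 0) -> l (g j) @[j --> \oo] --> 0 }.

Section mean_theory.
Variables (l : (X -> R) -> R) (lmean : is_mean l).

Let b0 := bounded_measurable_cst 0.
Let b1 := bounded_measurable_cst 1.

Lemma mean0 : l (fun=> 0) = 0.
Proof.
have := mean_lin _ lmean 1 _ _ b0 b0; under eq_fun do rewrite mulr0 addr0.
by rewrite mul1r => /eqP; rewrite -subr_eq subrr => /eqP.
Qed.

Lemma mean_cst c : l (fun=> c) = c.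
Proof.
have := mean_lin _ lmean c _ _ b1 b0; under eq_fun do rewrite mulr1 addr0.
by rewrite mean1// mean0 mulr1 addr0.
Qed.

Lemma meanB g h : bounded_measurable g -> bounded_measurable h ->
  l (fun x => g x - h x) = l g - l h.
Proof.
move=> bg bh; rewrite [RHS]addrC -mulN1r -mean_lin//.
by congr l; apply/funext => x; rewrite mulN1r addrC.
Qed.

Lemma le_mean g h : bounded_measurable g -> bounded_measurable h ->
  (forall x, g x <= h x) -> l g <= l h.
Proof.
move=> bg bh gh; rewrite -subr_ge0 -meanB//; apply: mean_ge0 => //.
  exact: bounded_measurableB.
by move=> x; rewrite subr_ge0.
Qed.

Lemma mean_itv g b c : bounded_measurable g ->
  (forall x, b <= g x <= c) -> b <= l g <= c.
Proof.
move=> bg gbc; rewrite -{1}(mean_cst b) -(mean_cst c).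
apply/andP; split; apply: le_mean => //; try exact: bounded_measurable_cst.
- by move=> x; case/andP: (gbc x).
- by move=> x; case/andP: (gbc x).
Qed.

Lemma mean_sum I (s : seq I) (a : I -> R) (g : I -> X -> R) :
  (forall i, bounded_measurable (g i)) ->
  l (fun x => \sum_(i <- s) a i * g i x) = \sum_(i <- s) a i * l (g i).
Proof.
move=> bg; elim: s => [|i s ih].
  by under eq_fun do rewrite big_nil; rewrite mean0 big_nil.
under eq_fun do rewrite big_cons.
by rewrite mean_lin ?ih ?big_cons//; exact: bounded_measurable_sum.
Qed.


(** The remainder, the indicator of the union minus the partial sums of
indicators, is bounded by 1 and tends to 0 pointwise, so [mean_cvg0] applies. *)
Lemma mean_semi_sigma_additive (F : nat -> set X) :
  (forall i, measurable (F i)) -> trivIset [set: nat] F ->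
  \sum_(0 <= i < n) l \1_(F i) @[n --> \oo] --> l \1_(\bigcup_n F n).
Proof.
move=> mF tF; set U := \bigcup_n F n.
have mU : measurable U by exact: bigcupT_measurable.
pose S n x : R := \sum_(0 <= i < n) 1 * \1_(F i) x.
have bF i : bounded_measurable (\1_(F i)) by exact: bounded_measurable_indic.
have bU : bounded_measurable \1_U by exact: bounded_measurable_indic.
have bS n : bounded_measurable (S n) by exact: bounded_measurable_sum.
have SU x : S ^~ x @ \oo --> (\1_U x : R).
  suff : (S n x)%:E @[n --> \oo] --> (\1_U x)%:E by exact: fine_cvg.
  rewrite indic_bigcup//.
  rewrite (_ : (fun n => _) = (fun n => \sum_(0 <= i < n) (\1_(F i) x)%:E)%E).
    by apply: is_cvg_nneseries => n _ _; rewrite lee_fin.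
  apply/funext => n; rewrite sumEFin; congr EFin.
  by apply: eq_bigr => i _; rewrite mul1r.
have lS n : \sum_(0 <= i < n) l \1_(F i) = l (S n).
  by rewrite mean_sum//; apply: eq_bigr => i _; rewrite mul1r.
under eq_fun do rewrite lS.
apply/subr_cvg0; under eq_fun do rewrite -meanB//.
apply: (mean_cvg0 _ lmean _ 1).
- by move=> n; have [] := bounded_measurableB _ _ (bS n) bU.
- move=> n x; rewrite distrC ger0_norm ?subr_ge0.
    apply: (@le_trans _ _ (\1_U x)); last by rewrite indicE lern1 leq_b1.
    by rewrite gerBl; apply: sumr_ge0 => i _; rewrite mul1r indicE.
  have <- := cvg_lim (@Rhausdorff R) (SU x).
  apply: nondecreasing_cvgn_le; last by apply: cvgP (SU x).
  apply/nondecreasing_seqP => k; rewrite /S big_nat_recr//= lerDl mul1r.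
  by rewrite indicE.
- by move=> x; exact/subr_cvg0.
Qed.

End mean_theory.

Import HBNNSimple.

Lemma mean_nnsfun l m (h : {nnsfun X >-> R}) : is_mean l -> is_mean m ->
  (forall A, measurable A -> l \1_A = m \1_A) ->
  l (fun x => h x) = m (fun x => h x).
Proof.
move=> lP mP lm; rewrite (_ : (fun x => h x) = fun x =>
    \sum_(y <- finmap.enum_fset (fset_set (range h)))
      y * \1_(h @^-1` [set y]) x); last first.
  by apply/funext => x; rewrite {1}fimfunE fsbig_finite.
have bh y : bounded_measurable (\1_(h @^-1` [set y])).
  exact: bounded_measurable_indic.
by rewrite !mean_sum//; apply: eq_bigr => y _; rewrite lm.
Qed.

(** A nonnegative bounded function is the limit of an increasing sequence of
simple functions below it, hence bounded by the same constant; adding a constant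
reduces the general case to the nonnegative one. *)
Lemma mean_ext l m : is_mean l -> is_mean m ->
  (forall A, measurable A -> l \1_A = m \1_A) ->
  forall g, bounded_measurable g -> l g = m g.
Proof.
move=> lP mP lm.
have nn g : bounded_measurable g -> (forall x, 0 <= g x) -> l g = m g.
  move=> bg g0; have [mg [M gM]] := bg.
  have mEg : measurable_fun [set: X] (EFin \o g) by exact/measurable_EFinP.
  pose h := nnsfun_approx measurableT mEg.
  have hg x : (h n x @[n --> \oo]) --> g x.
    suff : (h n x)%:E @[n --> \oo] --> (g x)%:E by exact: fine_cvg.
    by apply: cvg_nnsfun_approx => // y _; rewrite lee_fin.
  have hleg n x : h n x <= g x.
    rewrite -lee_fin /h nnsfun_approxE.
    by apply: le_approx => // y _; rewrite lee_fin.
  have bh n : bounded_measurable (fun x => h n x).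
    split; first exact: measurable_funPT.
    exists M => x.
    by rewrite ger0_norm// (le_trans (hleg _ _))// (le_trans (ler_norm _)).
  have hP k : is_mean k -> k (fun x => h n x) @[n --> \oo] --> k g.
    move=> kP; apply/subr_cvg0; under eq_fun do rewrite -meanB//.
    apply: (mean_cvg0 _ kP _ M).
    + by move=> n; have [] := bounded_measurableB _ _ (bh n) bg.
    + move=> n x; rewrite distrC ger0_norm ?subr_ge0//.
      by rewrite (le_trans _ (gM x))// (le_trans _ (ler_norm _))// gerBl.
    + by move=> x; exact/subr_cvg0.
  have lg := hP _ lP; have /cvg_lim <- // := hP _ mP.
  by apply/esym/cvg_lim => //; under eq_fun do rewrite -(mean_nnsfun l m)//.
move=> g bg; have [mg [M gM]] := bg.
have bc := bounded_measurable_cst.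
have bgM := bounded_measurableB _ _ bg (bc (- M)).
have := nn _ bgM; rewrite !meanB// !mean_cst// => /(_ _)/addIr; apply.
move=> x; rewrite opprK -lerBlDr sub0r.
by have := gM x; rewrite ler_norml => /andP[].
Qed.

Lemma bounded_measurable_integrable (mu : {measure set X -> \bar R}) g :
  (mu setT < +oo)%E -> bounded_measurable g -> mu.-integrable setT (EFin \o g).
Proof.
move=> muoo [mg [M gM]]; apply: measurable_bounded_integrable => //.
exists M; split; first exact: num_real.
by move=> r Mr x _ /=; rewrite (le_trans (gM x))// ltW.
Qed.

Lemma Rintegral_is_mean (mu : {measure set X -> \bar R}) :
  mu setT = 1%E -> is_mean (fun g => \int[mu]_x g x).
Proof.
move=> muT.
have bi g : bounded_measurable g -> mu.-integrable setT (EFin \o g).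
  by apply: bounded_measurable_integrable; rewrite muT ltry.
split.
- by rewrite Rintegral_cst// mul1r muT.
- move=> a g h bg bh; rewrite RintegralD ?RintegralZl//; try exact: bi.
  have := bi _ (bounded_measurable_lin a _ _ bg (bounded_measurable_cst 0)).
  by under eq_fun do rewrite /= addr0.
- by move=> g _ g0; apply: Rintegral_ge0.
- move=> g M mg gM g0.
  suff : (\int[mu]_x (g n x)%:E)%E @[n --> \oo] --> 0%E by exact: fine_cvg.
  rewrite -(integral0 mu [set: X]).
  apply: (@dominated_cvg _ _ _ mu setT measurableT
    (fun n x => (g n x)%:E) _ (cst M%:E)) => //.
  + by move=> n; exact/measurable_EFinP.
  + by move=> x _; apply: cvg_EFin; [exact: nearW|exact: g0].
  + exact: bi _ (bounded_measurable_cst M).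
  + by move=> n x _; rewrite lee_fin.
Qed.

(** The measure of A is the mean of its indicator. *)
Lemma mean_representation l : is_mean l ->
  exists mu : probability X R,
    forall g, bounded_measurable g -> l g = \int[mu]_x g x.
Proof.
move=> lP.
(* A measure has to be nonnegative on all sets, and nothing is known of [l] on
   the indicator of a nonmeasurable set: hence the absolute value. *)
pose mu A : \bar R := `|l \1_A|%:E.
have muE A : measurable A -> mu A = (l \1_A)%:E.
  move=> mA; rewrite /mu ger0_norm//; apply: mean_ge0 => //.
  exact: bounded_measurable_indic.
have mu0 : mu set0 = 0%E by rewrite muE// indic0 mean_cst.
have mu_ge0 A : (0 <= mu A)%E by rewrite lee_fin.
have mu_sigma : semi_sigma_additive mu.
  move=> F mF tF mU; rewrite muE//.
  rewrite (_ : (fun n => _) = fun n => (\sum_(0 <= i < n) l \1_(F i))%:E).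
  by apply: cvg_EFin; [exact: nearW|exact: mean_semi_sigma_additive].
  by apply/funext => n; rewrite -sumEFin; apply: eq_bigr => i _; rewrite muE.
have muT : mu setT = 1%E by rewrite muE// indicT mean_cst.
pose mu1 : {measure set X -> \bar R} :=
  HB.pack mu (isMeasure.Build _ _ _ mu mu0 mu_ge0 mu_sigma).
pose mu2 : probability X R :=
  HB.pack mu (isMeasure.Build _ _ _ mu mu0 mu_ge0 mu_sigma)
    (Measure_isProbability.Build _ _ _ mu1 muT).
exists mu2; apply: mean_ext => //.
  exact: Rintegral_is_mean (probability_setT mu2).
move=> A mA; rewrite /Rintegral integral_indic// setIT.
exact: (esym (congr1 fine (muE A mA))).
Qed.

End bounded_measurable.

(** * Doeblin's condition and the ergodic mean *)

Section markov_operator.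
Context {d} {X : measurableType d} {R : realType} (p : R.-pker X ~> X).
Implicit Types (g h : X -> R).

Definition markov_op g : X -> R := fun x => \int[p x]_y g y.

Lemma markov_op_mean x : is_mean (fun g => markov_op g x).
Proof. by apply: Rintegral_is_mean; exact: prob_kernel. Qed.

(** Measurability in the parameter of the kernel is a statement about
nonnegative integrands, so [g] is first shifted by its bound. *)
Lemma bounded_measurable_markov_op g :
  bounded_measurable g -> bounded_measurable (markov_op g).
Proof.
move=> bg; have [mg [M gM]] := bg.
have bc := @bounded_measurable_cst _ X R.
have bgM := bounded_measurableB _ _ bg (bc (- M)).
split; last first.
  exists M => x; rewrite ler_norml.
  apply: (mean_itv _ (markov_op_mean x)) => // y.
  by rewrite -ler_norml.
have -> : markov_op g = fun x => markov_op (fun y => g y - - M) x + - M.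
  apply/funext => x; have mx := markov_op_mean x.
  by rewrite (meanB _ mx)// (mean_cst _ mx) subrK.
apply: measurable_funD => //; apply: measurableT_comp => //.
apply: measurable_fun_integral_kernel.
- by move=> U mU; exact: (measurable_kernel p U mU).
- move=> y; rewrite lee_fin opprK -lerBlDr sub0r.
  by have := gM y; rewrite ler_norml => /andP[].
- by apply/measurable_EFinP; have [] := bgM.
Qed.

Lemma bounded_measurable_iter k g :
  bounded_measurable g -> bounded_measurable (iter k markov_op g).
Proof. by move=> bg; elim: k => //= k; exact: bounded_measurable_markov_op. Qed.

Lemma iter_markov_op_mean k x : is_mean (fun g => iter k markov_op g x).
Proof.
elim: k x => [|k ih] x.
  by split=> //= [g _|g M _ _]; exact.
have mx := markov_op_mean x.
split=> /=.
- rewrite (_ : iter k _ _ = fun=> 1) ?(mean1 _ mx)//.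
  by apply/funext => y; exact: (mean1 _ (ih y)).
- move=> a g h bg bh.
  rewrite -(mean_lin _ mx); try exact: bounded_measurable_iter.
  by congr markov_op; apply/funext => y; exact: (mean_lin _ (ih y)).
- move=> g bg g0; apply: (mean_ge0 _ mx); first exact: bounded_measurable_iter.
  by move=> y; exact: (mean_ge0 _ (ih y)).
- move=> g M mg gM g0.
  have bg j : bounded_measurable (g j) by split; [|exists M; exact: gM].
  apply: (mean_cvg0 _ mx _ M).
  + by move=> j; have [] := bounded_measurable_iter k _ (bg j).
  + move=> j y; rewrite ler_norml; apply: (mean_itv _ (ih y)) => //.
    by move=> z; rewrite -ler_norml.
  + by move=> y; exact: (mean_cvg0 _ (ih y) _ M).
Qed.

Lemma iter_markov_op_itv k g (b c : R) : bounded_measurable g ->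
  (forall x, b <= g x <= c) -> forall x, b <= iter k markov_op g x <= c.
Proof.
by move=> bg gbc x; exact: (mean_itv _ (iter_markov_op_mean k x)).
Qed.

Section doeblin.
Variables (N : nat) (a : R) (z : X).
Hypothesis a_gt0 : 0 < a.
Hypothesis minorization : forall g, bounded_measurable g ->
  (forall x, 0 <= g x) -> forall x, a * g z <= iter N markov_op g x.

(** Apply the minorization to the constant 1. *)
Lemma minorization_le1 : a <= 1.
Proof.
have := minorization _ (bounded_measurable_cst 1) (fun=> ler01) z.
by rewrite mulr1 (mean1 _ (iter_markov_op_mean N z)).
Qed.

(** If [b' <= h <= c'], the minorization applied to [h - b'] raises the lower
bound of the N-th iterate of [h] by [a * (h z - b')], and applied to [c' - h] it
lowers the upper bound by [a * (c' - h z)]. Since the same value [h z] occurs in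
both, the total gain is [a * (c' - b')] whatever that value is. Further
iterations keep a function between the bounds reached. *)
Lemma oscillation_iter j g (b c : R) : bounded_measurable g ->
  (forall x, b <= g x <= c) -> exists b' c',
    c' - b' = (1 - a) ^+ j * (c - b) /\
    forall k, (j * N <= k)%N -> forall x, b' <= iter k markov_op g x <= c'.
Proof.
move=> bg gbc; elim: j => [|j [b' [c' [bc' kbc']]]].
  exists b, c; rewrite mul1r; split => // k _; exact: iter_markov_op_itv.
set h := iter (j * N) markov_op g.
have bh : bounded_measurable h by exact: bounded_measurable_iter.
have hbc : forall x, b' <= h x <= c' by exact: kbc'.
exists (b' + a * (h z - b')), (c' - a * (c' - h z)); split.
  by rewrite exprS -mulrA -bc'; lra.
move=> k Nk; rewrite -(subnK Nk) iterD mulSn iterD -/h.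
apply: iter_markov_op_itv; first exact: bounded_measurable_iter.
move=> x; have mx := iter_markov_op_mean N x.
have bc r := @bounded_measurable_cst _ X R r.
have hb : a * (h z - b') <= iter N markov_op h x - b'.
  rewrite -[X in _ <= _ - X](mean_cst _ mx) -(meanB _ mx)//.
  apply: (minorization (fun y => h y - b')); first exact: bounded_measurableB.
  by move=> y; rewrite subr_ge0; case/andP: (hbc y).
have hc : a * (c' - h z) <= c' - iter N markov_op h x.
  rewrite -[X in _ <= X - _](mean_cst _ mx) -(meanB _ mx)//.
  apply: (minorization (fun y => c' - h y)); first exact: bounded_measurableB.
  by move=> y; rewrite subr_ge0; case/andP: (hbc y).
by apply/andP; split; lra.
Qed.

(** The bound is uniform in the points [x] and [x'], which makes the limit a
constant, and in [g] as long as [M] is kept, which makes the limit countably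
additive. *)
Lemma iter_markov_op_cauchy j g (M : R) : bounded_measurable g ->
  (forall x, `|g x| <= M) -> forall k k' x x',
  (j * N <= k)%N -> (j * N <= k')%N ->
  `|iter k markov_op g x - iter k' markov_op g x'| <= (1 - a) ^+ j * (2 * M).
Proof.
move=> bg gM k k' x x' jk jk'.
have [|b [c [bc kbc]]] := oscillation_iter j g (- M) M bg.
  by move=> y; rewrite -ler_norml.
have /andP[? ?] := kbc _ jk x; have /andP[? ?] := kbc _ jk' x'.
rewrite (_ : 2 * M = M - - M) -?bc; last by lra.
by rewrite ler_norml; apply/andP; split; lra.
Qed.

Lemma contraction_cvg0 (M : R) : (1 - a) ^+ j * M @[j --> \oo] --> 0.
Proof.
rewrite -[0](mul0r M); apply: cvgMl; apply: cvg_expr.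
have := minorization_le1; have := a_gt0 => ? ?.
by rewrite ger0_norm; lra.
Qed.

Definition ergodic_mean g := limn (fun k => iter k markov_op g z).

Lemma cvg_ergodic_mean g : bounded_measurable g -> forall x,
  iter k markov_op g x @[k --> \oo] --> ergodic_mean g.
Proof.
move=> bg x; have [_ [M gM]] := bg.
have small e : 0 < e -> exists j, (1 - a) ^+ j * (2 * M) < e.
  move=> e0; have := contraction_cvg0 (2 * M).
  move=> /cvgr_lt/(_ e e0)[j _ /(_ j (leqnn j))].
  by exists j.
have cz : iter k markov_op g z @[k --> \oo] --> ergodic_mean g.
  apply: cauchy_cvg; apply: cauchy_exP => e e0; have [j je] := small e e0.
  exists (iter (j * N) markov_op g z); exists (j * N)%N => // k /= jk.
  by apply: le_lt_trans je; exact: iter_markov_op_cauchy.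
rewrite -[ergodic_mean g]add0r.
rewrite (_ : (fun k => _) = fun k =>
    (iter k markov_op g x - iter k markov_op g z) + iter k markov_op g z);
  last by apply/funext => k; rewrite subrK.
apply: cvgD => //; apply/cvgr0Pnorm_lt => e e0; have [j je] := small e e0.
exists (j * N)%N => // k /= jk.
by apply: le_lt_trans je; exact: iter_markov_op_cauchy.
Qed.

Lemma ergodic_mean_rate j g (M : R) : bounded_measurable g ->
  (forall x, `|g x| <= M) ->
  `|ergodic_mean g - iter (j * N) markov_op g z| <= (1 - a) ^+ j * (2 * M).
Proof.
move=> bg gM.
have : `|iter k markov_op g z - iter (j * N) markov_op g z| @[k --> \oo] -->
    `|ergodic_mean g - iter (j * N) markov_op g z|.
  by apply: cvg_norm; apply: cvgB; [exact: cvg_ergodic_mean|exact: cvg_cst].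
move=> /cvgr_to_le; apply.
by exists (j * N)%N => // k /= jk; exact: iter_markov_op_cauchy.
Qed.

Lemma ergodic_mean_is_mean : is_mean ergodic_mean.
Proof.
have cvgl := cvg_ergodic_mean; have mk k := iter_markov_op_mean k z.
split.
- apply/cvg_lim => //; under eq_fun do rewrite (mean1 _ (mk _)).
  exact: cvg_cst.
- move=> b g h bg bh; apply/cvg_lim => //.
  under eq_fun do rewrite (mean_lin _ (mk _))//.
  by apply: cvgD; [apply: cvgMr|]; exact: cvgl.
- move=> g bg g0; apply: (cvgr_to_ge (cvgl _ bg z)).
  by apply: nearW => k; exact: (mean_ge0 _ (mk k)).
- move=> g M mg gM g0.
  have bg j : bounded_measurable (g j) by split; [|exists M; exact: gM].
  (* [J] is chosen first, uniformly in [j]; the bounded convergence property is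
     then used for the fixed iterate [J * N] only. *)
  apply/cvgr0Pnorm_lt => e e0; have e20 : 0 < e / 2 by rewrite divr_gt0.
  have /cvgr_lt/(_ _ e20)[J _ /(_ J (leqnn J)) Je] := contraction_cvg0 (2 * M).
  have := mean_cvg0 _ (mk (J * N)%N) _ _ mg gM g0.
  move=> /cvgr0Pnorm_lt/(_ _ e20); apply: filterS => j je.
  rewrite -(subrK (iter (J * N) markov_op (g j) z) (ergodic_mean _)).
  rewrite (le_lt_trans (ler_normD _ _))// [e]splitr ltr_leD ?ltW//.
  exact: le_lt_trans (ergodic_mean_rate J _ _ (bg j) (gM j)) Je.
Qed.

Theorem doeblin_ergodic : exists mu : probability X R,
  forall g, bounded_measurable g -> forall x,
    iter k markov_op g x @[k --> \oo] --> \int[mu]_y g y.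
Proof.
have [mu muP] := mean_representation _ ergodic_mean_is_mean.
by exists mu => g bg x; rewrite -muP//; exact: cvg_ergodic_mean.
Qed.

End doeblin.
End markov_operator.

(** * Minorization by the atom of the exogenous process *)

Section minorization.
Context {R : realType} {E D : ptopologicalType}.
Variable q : R.-pker (borel E) ~> (borel E).
Variable f : {mfun (state E D * borel E)%type >-> state E D}.
Variables (estar : borel E) (eps : R).
Hypothesis eps_gt0 : 0 < eps.
Hypothesis mestar : measurable [set estar].
Hypothesis qeps : forall e, (eps%:E <= q e [set estar])%E.

Let mf x : measurable_fun [set: borel E] (fun e => f (x, e)).
Proof. exact: measurableT_comp. Qed.

(** The part of the integral that lies over the atom [estar] of the exogenous
process already gives the bound. *)
Lemma transition_ge_atom g x : bounded_measurable g -> (forall y, 0 <= g y) ->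
  eps * g (f (x, estar)) <= markov_op (transition q f) g x.
Proof.
move=> bg g0; have [mg [M gM]] := bg.
have mEg : measurable_fun setT (EFin \o g) by exact/measurable_EFinP.
rewrite -lee_fin /markov_op /Rintegral fineK; last first.
  apply: integrable_fin_num => //; apply: bounded_measurable_integrable bg.
  by rewrite prob_kernel ltry.
have -> : (\int[transition q f x]_y (g y)%:E =
    \int[q (exo x)]_e (g (f (x, e)))%:E)%E.
  rewrite -(ge0_integral_pushforward (mf x) (q (exo x)) measurableT mEg)//.
  by move=> y _; rewrite lee_fin.
apply: (@le_trans _ _
  (\int[q (exo x)]_(e in [set estar]) (g (f (x, e)))%:E)%E); last first.
  apply: ge0_subset_integral => //.
    by apply/measurable_EFinP; exact: measurableT_comp.
  by move=> e _; rewrite lee_fin.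
rewrite (eq_integral (cst (g (f (x, estar)))%:E)); last first.
  by move=> e; rewrite inE => ->.
rewrite integral_cst// mulrC EFinM; apply: lee_wpmul2l; last exact: qeps.
by rewrite lee_fin.
Qed.

Lemma exo_iterSr k x e : exo_iter f k.+1 (x, e) = exo_iter f k (f (x, e), e).
Proof. by rewrite /exo_iter iterSr. Qed.

Lemma iter_transition_ge_atom k g x :
  bounded_measurable g -> (forall y, 0 <= g y) ->
  eps ^+ k * g (exo_iter f k (x, estar)) <=
    iter k (markov_op (transition q f)) g x.
Proof.
move=> bg g0; elim: k x => [|k ih] x; first by rewrite mul1r.
have bk := bounded_measurable_iter (transition q f) k g bg.
apply: le_trans (transition_ge_atom _ x bk _).
  by rewrite exprS -mulrA ler_pM2l// exo_iterSr; exact: ih.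
move=> y; apply: le_trans (ih y); apply: mulr_ge0 => //.
by rewrite exprn_ge0// ltW.
Qed.

End minorization.

(** * Complex-valued functions *)

Section complex_valued.
Context {R : realType}.

Lemma measurable_continuous_borel (T : ptopologicalType) (h : T -> R) :
  continuous h -> measurable_fun [set: borel T] (h : borel T -> R).
Proof.
move=> /continuousP ch.
apply: (@measurability _ _ (borel T) R _ _ _ (RGenOpens.measurableE R)).
move=> _ [_ [a [b ->] <-]]; rewrite setTI; apply: sub_sigma_algebra.
exact/ch/interval_open.
Qed.

Lemma normc_ge_Im (z : R[i]) : (`|complex.Im z|%:C <= `|z|)%C.
Proof.
have := normc_ge_Re (z * 'i%C); rewrite ReiNIm normrN normrM.
by rewrite (normc_def 'i%C)/= expr0n expr1n add0r sqrtr1 mulr1.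
Qed.

Lemma continuous_lip1 (h : cplx R -> R) :
  (forall x y : cplx R, (`|h x - h y|%:C <= `|x - y|)%C) -> continuous h.
Proof.
move=> hlip z; apply/(@cvgrPdist_lt _ _ _ _ (nbhs_filter (z : cplx R))) => e e0.
apply/(@nbhs_ballP _ (cplx R)); exists e%:C%C => [|t]; first by rewrite /= ltcR.
by rewrite -ball_normE/= => /(le_lt_trans (hlip z t)); rewrite ltcR.
Qed.

Lemma continuous_Re : continuous (@complex.Re R : cplx R -> R).
Proof.
by apply: continuous_lip1 => x y; rewrite -raddfB; exact: normc_ge_Re.
Qed.

Lemma continuous_Im : continuous (@complex.Im R : cplx R -> R).
Proof.
by apply: continuous_lip1 => x y; rewrite -raddfB; exact: normc_ge_Im.
Qed.

Lemma cvg_complex (u : nat -> cplx R) (l : cplx R) :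
  complex.Re (u m) @[m --> \oo] --> complex.Re l ->
  complex.Im (u m) @[m --> \oo] --> complex.Im l ->
  u @ \oo --> l.
Proof.
move=> ul vl; apply/cvgrPdist_lt => -[e e'].
rewrite ltcE/= => /andP[/eqP-> e0]; have e20 : 0 < e / 2 by rewrite divr_gt0.
near=> m; rewrite [_ - _]complexE (le_lt_trans (ler_normD _ _))//.
rewrite normrM (normc_def 'i%C)/= expr0n expr1n add0r sqrtr1 mul1r.
rewrite !normc_def/= expr0n/= !addr0 !sqrtr_sqr.
rewrite [e]splitr -rmorphD ltcR !raddfB ltrD//; near: m.
- exact: (cvgrPdist_lt _ _).1 ul _ e20.
- exact: (cvgrPdist_lt _ _).1 vl _ e20.
Unshelve. all: by end_near. Qed.

Context d (X : measurableType d).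

Lemma Mstar_Re (g : X -> cplx R) :
  Mstar g -> bounded_measurable (fun x => complex.Re (g x)).
Proof.
move=> [mg [M gM]]; split.
  exact: (measurableT_comp (measurable_continuous_borel _ _ continuous_Re) mg).
by exists M => x; rewrite -lecR; exact: le_trans (normc_ge_Re _) (gM x).
Qed.

Lemma Mstar_Im (g : X -> cplx R) :
  Mstar g -> bounded_measurable (fun x => complex.Im (g x)).
Proof.
move=> [mg [M gM]]; split.
  exact: (measurableT_comp (measurable_continuous_borel _ _ continuous_Im) mg).
by exists M => x; rewrite -lecR; exact: le_trans (normc_ge_Im _) (gM x).
Qed.

Lemma iter_Tstar (p : R.-pker X ~> X) k (g : X -> cplx R) x :
  iter k (Tstar p) g x = (iter k (markov_op p) (fun y => complex.Re (g y)) x +i*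
   iter k (markov_op p) (fun y => complex.Im (g y)) x)%C.
Proof.
elim: k x => [|k ih] x /=; first by case: (g x).
by congr (_ +i* _)%C; apply: eq_Rintegral => y _; rewrite ih.
Qed.

Lemma cvg_average (u : nat -> R) (l : R) : u @ \oo --> l ->
  m%:R^-1 * (\sum_(0 <= i < m) u i) @[m --> \oo] --> l.
Proof. by move=> /cesaro ul; rewrite -cvg_shiftS. Qed.

Lemma Re_average m (u : nat -> cplx R) :
  complex.Re (m%:R^-1 * (\sum_(0 <= i < m) u i)) =
  m%:R^-1 * (\sum_(0 <= i < m) complex.Re (u i)).
Proof.
have -> : (m%:R^-1 : R[i]) = (m%:R^-1)%:C%C by rewrite fmorphV rmorph_nat.
rewrite -raddf_sum; case: (\sum_(_ <= _ < _) _) => a b /=.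
by rewrite mul0r subr0.
Qed.

Lemma Im_average m (u : nat -> cplx R) :
  complex.Im (m%:R^-1 * (\sum_(0 <= i < m) u i)) =
  m%:R^-1 * (\sum_(0 <= i < m) complex.Im (u i)).
Proof.
have -> : (m%:R^-1 : R[i]) = (m%:R^-1)%:C%C by rewrite fmorphV rmorph_nat.
rewrite -raddf_sum; case: (\sum_(_ <= _ < _) _) => a b /=.
by rewrite mul0r addr0.
Qed.

End complex_valued.

(** * Convergence of the averages *)

Theorem corollary2 (R : realType) (E D : ptopologicalType)
  (q : R.-pker (borel E) ~> (borel E))
  (F : state E D * borel E -> set (state E D))
  (Fuhc : upper_hemicontinuous F)
  (Fexo : forall x e y, F (x, e) y -> exo y = e)
  (K : set (state E D)) (mK : measurable K)
  (fK : forall f : {mfun (state E D * borel E)%type >-> state E D},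
    selection F f -> forall x e, K (f (x, e)))
  (estar : borel E) (xstar : state E D) (n : nat) (n0 : (0 < n)%N)
  (fn : forall f : {mfun (state E D * borel E)%type >-> state E D},
    selection F f -> forall x, K x -> exo_iter f n (x, estar) = xstar)
  (eps : R) (eps0 : 0 < eps)
  (mestar : measurable [set estar])
  (qeps : forall e, (eps%:E <= q e [set estar])%E) :
  forall f : {mfun (state E D * borel E)%type >-> state E D},
    selection F f ->
  exists mu : probability (state E D) R,
  forall g : state E D -> cplx R, Mstar g -> forall x,
    m%:R^-1 * (\sum_(0 <= i < m) iter i (Tstar (transition q f)) g x)
      @[m --> \oo] --> cintegral mu g.
Proof.
move=> f fF.
have minor g : bounded_measurable g -> (forall y, 0 <= g y) -> forall x,
    eps ^+ n.+1 * g xstar <= iter n.+1 (markov_op (transition q f)) g x.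
  move=> bg g0 x.
  have := iter_transition_ge_atom q f _ _ eps0 mestar qeps n.+1 g x bg g0.
  suff -> : exo_iter f n.+1 (x, estar) = xstar by [].
  by rewrite exo_iterSr fn//; exact: fK.
have [mu muP] := doeblin_ergodic _ _ _ _ (exprn_gt0 n.+1 eps0) minor.
exists mu => g gM x; apply: cvg_complex.
- under eq_fun do rewrite Re_average; apply: cvg_average.
  under eq_fun do rewrite iter_Tstar; apply: muP; exact: Mstar_Re.
- under eq_fun do rewrite Im_average; apply: cvg_average.
  under eq_fun do rewrite iter_Tstar; apply: muP; exact: Mstar_Im.
Qed.
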